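(* For every $n\ge 1$, the number of web permutations of $[n]$ is equal to the Euler number $E_{n+1}$.
   Context: **Euler numbers.** $E_n$ is defined by $\sum_{n\ge 0}E_n\frac{z^n}{n!}=\sec z+\tan z$. **Web permutations.** The cells of the $n\times n$ grid are indexed by $(i,j)$ with $1\le i,j\le n$ ($i$ is the $x$-coordinate, $j$ the $y$-coordinate). For $\sigma\in\mathfrak{S}_n$, a cell $(i,j)$ is a crossing of $\sigma$ if $\sigma(i)<j$ and $i<\sigma^{-1}(j)$; $\mathrm{Cr}(\sigma)$ is the set of crossings. A grid configuration is $G(\sigma,E)$, determined by a pair $(\sigma,E)$ with $\sigma\in\mathfrak{S}_n$ and $E\subseteq\mathrm{Cr}(\sigma)$; its remaining crossings are the elements of $\mathrm{Cr}(\sigma)\setminus E$. Order cells by $(x,y)\succeq(x',y')$ iff $x\le x'$ and $y\ge y'$. If $c=(i,j)$ is a $\succeq$-maximal remaining crossing of $G(\sigma,E)$, resolving $c$ produces two grid configurations: $G(\sigma,E\cup\{c\})$ (smoothing) and $G(\sigma',E)$ (switching), where $\sigma'(i)=j$, $\sigma'(\sigma^{-1}(j))=\sigma(i)$, and $\sigma'(k)=\sigma(k)$ for $k\ne i,\sigma^{-1}(j)$ (one has $E\subseteq\mathrm{Cr}(\sigma')$). Start from $G(\mathrm{id},\emptyset)$ and repeatedly replace each grid configuration having a remaining crossing by the two obtained by resolving a maximal one, until all are of the form $G(\sigma,\mathrm{Cr}(\sigma))$. The permutations $\sigma$ occurring are the web permutations of $[n]$ (the result does not depend on the choices of maximal crossings).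 *)

(* Defs.v *)
From HB Require Import structures.
From mathcomp Require Import all_boot all_order all_algebra all_fingroup.

Set Implicit Arguments.
Unset Strict Implicit.
Unset Printing Implicit Defensive.

Import GRing.Theory.
Local Open Scope ring_scope.

(* A formal power series \sum_n f n * z ^ n with
   rational coefficients is its coefficient sequence f : nat -> rat. *)

Definition fps_one (n : nat) : rat := (n == 0)%:R.

Definition fps_add (f g : nat -> rat) (n : nat) : rat := f n + g n.

Definition fps_mul (f g : nat -> rat) (n : nat) : rat :=
  \sum_(i < n.+1) f i * g (n - i)%N.

(* The first n.+1 coefficients of 1 / f, see fps_mulV; meaningful only when
   f 0 != 0. *)
Fixpoint fps_inv_seq (f : nat -> rat) (n : nat) : seq rat :=
  if n is m.+1 then
    let s := fps_inv_seq f m in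
    rcons s (- (f 0)^-1 * \sum_(i < m.+1) s`_i * f (m.+1 - i)%N)
  else [:: (f 0)^-1].

Definition fps_inv (f : nat -> rat) (n : nat) : rat := (fps_inv_seq f n)`_n.

Lemma size_fps_inv_seq f n : size (fps_inv_seq f n) = n.+1.
Proof. by elim: n => //= n IHn; rewrite size_rcons IHn. Qed.

Lemma nth_fps_inv_seq f n i : (i <= n)%N -> (fps_inv_seq f n)`_i = fps_inv f i.
Proof.
elim: n => [|n IHn]; first by rewrite leqn0 => /eqP->.
rewrite leq_eqVlt => /predU1P[-> //|lt_in] /=.
by rewrite nth_rcons size_fps_inv_seq lt_in IHn.
Qed.

Lemma fps_mulV f : f 0%N != 0 -> fps_mul (fps_inv f) f =1 fps_one.
Proof.
move=> f0 [|n]; rewrite /fps_mul /fps_one big_ord_recr /= subnn.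
  by rewrite big_ord0 add0r /fps_inv /= mulVf.
rewrite [fps_inv f n.+1]/fps_inv /= nth_rcons size_fps_inv_seq ltnn eqxx.
rewrite mulrAC mulNr mulVf // mulN1r; apply/eqP; rewrite subr_eq0; apply/eqP.
by apply: eq_bigr => i _; rewrite nth_fps_inv_seq // -ltnS.
Qed.

Definition fps_sin (n : nat) : rat :=
  if odd n then (-1) ^+ n./2 / n`!%:R else 0.

Definition fps_cos (n : nat) : rat :=
  if odd n then 0 else (-1) ^+ n./2 / n`!%:R.

Definition fps_sec : nat -> rat := fps_inv fps_cos.

Definition fps_tan : nat -> rat := fps_mul fps_sin fps_sec.

Definition euler (n : nat) : rat := n`!%:R * fps_add fps_sec fps_tan n.

Lemma euler_egf (n : nat) : euler n / n`!%:R = fps_add fps_sec fps_tan n.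
Proof.
by rewrite /euler mulrAC mulfV ?mul1r // Num.Theory.pnatr_eq0 -lt0n fact_gt0.
Qed.

(* [n] is represented by 'I_n = {0, ..., n-1}; all notions below depend only
   on the order of the indices, so the shift by one is harmless. *)

Definition cell (n : nat) : finType := ('I_n * 'I_n)%type.

Definition crossings (n : nat) (s : 'S_n) : {set cell n} :=
  [set c : cell n | (s c.1 < c.2)%N && (c.1 < (s^-1)%g c.2)%N].

(* The pair (s, E) encodes G(s, E).  The condition E \subset crossings s is
   not built into the type: it holds for (1, set0) and, by
   config_reachable_sub, for everything obtained from it by resolutions. *)
Definition config (n : nat) : finType := ('S_n * {set cell n})%type.

Definition remaining (n : nat) (g : config n) : {set cell n} :=
  crossings g.1 :\: g.2.

Definition cell_ge (n : nat) (c d : cell n) : bool :=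
  (c.1 <= d.1)%N && (d.2 <= c.2)%N.

Definition maximal_remaining (n : nat) (g : config n) (c : cell n) : bool :=
  (c \in remaining g) && [forall d in remaining g, cell_ge d c ==> (d == c)].

Definition smoothing (n : nat) (g : config n) (c : cell n) : config n :=
  (g.1, c |: g.2).

(* Permutations compose from left to right: (s * t)%g x = t (s x). *)
Definition switch_perm (n : nat) (s : 'S_n) (c : cell n) : 'S_n :=
  (tperm c.1 ((s^-1)%g c.2) * s)%g.

Lemma switch_permE (n : nat) (s : 'S_n) (i j : 'I_n) :
  [/\ switch_perm s (i, j) i = j,
      switch_perm s (i, j) ((s^-1)%g j) = s i
    & forall k, k != i -> k != (s^-1)%g j -> switch_perm s (i, j) k = s k].
Proof.
split=> [||k ki kj]; rewrite /switch_perm permM /=.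
- by rewrite tpermL permKV.
- by rewrite tpermR.
- by rewrite tpermD // eq_sym.
Qed.

Definition switching (n : nat) (g : config n) (c : cell n) : config n :=
  (switch_perm g.1 c, g.2).

Definition resolve (n : nat) : rel (config n) := fun g h =>
  [exists c, maximal_remaining g c &&
    ((h == smoothing g c) || (h == switching g c))].

Lemma switch_crossingE (n : nat) (s : 'S_n) (c d : cell n) :
  c \in crossings s -> ~~ cell_ge c d ->
  (d \in crossings (switch_perm s c)) = (d \in crossings s).
Proof.
case: c d => [i j] [x y]; rewrite !inE /cell_ge /switch_perm /= negb_and.
case/andP=> lt_j lt_i; rewrite -!ltnNge invMg tpermV !permM.
set k := (s^-1)%g j in lt_i *; have sk : s k = j by rewrite permKV.
move=> out; congr andb.
  case: tpermP => [xi|xk|//].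
    by move: out; rewrite xi sk ltnn /= => jy; rewrite jy (ltn_trans lt_j).
  move: out; rewrite xk sk ltnNge (ltnW lt_i) /= => jy.
  by rewrite jy (ltn_trans lt_j).
case: tpermP => [yi|yk|//].
  have yE : y = s i by rewrite -yi permKV.
  move: out; rewrite yE [(j < _)%N]ltnNge (ltnW lt_j) orbF => xi.
  by rewrite permK xi (ltn_trans xi).
have yE : y = j by rewrite -sk -yk permKV.
move: out; rewrite yE ltnn orbF => xi.
by rewrite -/k xi (ltn_trans xi).
Qed.

Lemma config_reachable_sub (n : nat) (g : config n) :
  connect (@resolve n) (1%g, set0) g -> g.2 \subset crossings g.1.
Proof.
pose up (h : config n) := forall c d,
  c \in crossings h.1 -> d \in h.2 -> cell_ge c d -> c \in h.2.
suff inv p h : path (@resolve n) h p -> h.2 \subset crossings h.1 -> up h ->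
    (last h p).2 \subset crossings (last h p).1.
  case/connectP=> p /inv inv_p ->; apply: inv_p; first exact: sub0set.
  by move=> c d _; rewrite inE.
elim: p h => //= h' p IHp h /andP[hh' /IHp {}IHp] /subsetP subh uph.
case/existsP: hh' => c /andP[/andP[]]; rewrite in_setD => /andP[cNE cCr].
move/forall_inP=> cmax /orP[] /eqP def_h'.
  apply: IHp; rewrite def_h' /=.
    by apply/subsetP=> d /setU1P[->|/subh].
  move=> a d /= aCr /setU1P[->|dE] ad; last by rewrite !inE (uph a d) ?orbT.
  apply/setU1P; case: (boolP (a \in h.2)) => [|aNE]; [by right | left].
  by apply/eqP/(implyP (cmax a _)); rewrite ?in_setD ?aNE.
have out d : d \in h.2 -> ~~ cell_ge c d.
  by move=> dE; apply: contra cNE => /uph->.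
apply: IHp; rewrite def_h' /=.
  by apply/subsetP=> d dE; rewrite (switch_crossingE cCr (out d dE)); apply: subh.
move=> a d /= aCr dE ad; apply: (uph a d) => //.
rewrite -(switch_crossingE cCr) //; apply: contra (out d dE).
case/andP: ad => a1 a2 /andP[c1 c2].
by rewrite /cell_ge (leq_trans c1) ?(leq_trans a2).
Qed.

(* s occurs at the end of the process, for some choice of the maximal
   crossings that are resolved, iff G(s, Cr(s)) is reachable from G(id, 0). *)
Definition web_permutations (n : nat) : {set 'S_n} :=
  [set s : 'S_n |
    connect (@resolve n) ((1%g : 'S_n), set0) (s, crossings s)].

(* Main.v *)
Require Import Defs.
From mathcomp Require Import all_boot all_order all_algebra all_fingroup.
From mathcomp Require Import ring.

Import GRing.Theory.
Local Open Scope ring_scope.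

(* Resolutions of distinct maximal crossings commute, so a web permutation is
   obtained by resolving column by column, each column from the top.  In column
   k this amounts to keeping s k or exchanging it with a larger value occurring
   to the right; hence only the word s k, s (k + 1), ... matters: its first
   letter a is erased, possibly after replacing one letter greater than a by a.
   Since the value finally at k tells which letter was replaced, web
   permutations correspond bijectively to the histories of this process.
   Tracing which letters end up merged into the last letter of the word (the
   cycle of the maximum) gives, for the numbers F m of histories of increasing
   words of length m and E m of those whose letters are all merged into one
   large letter, F (m + 1) = \sum_k C(m, k) E k F (m - k) and, exchanging the
   two parts of a splitting of the word,
   2 E (m + 1) = \sum_k C(m, k) E k E (m - k) + [m = 0].  The latter is the
   equation 2 y' = y ^ 2 + 1 of y = sec + tan, and then F m = E (m + 1). *)

(** * Histories of words *)

Fixpoint repl (a : nat) (w : seq nat) : seq (seq nat) :=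
  if w is y :: w' then
    (if (a < y)%N then [:: a :: w'] else [::]) ++ [seq y :: v | v <- repl a w']
  else [::].

(* A sink Some b is one more letter b after the end of the word; the sink None
   stands for the closed cycles and absorbs every letter unchanged. *)
Definition absorbs (x : option nat) (a : nat) : bool :=
  if x is Some b then (a < b)%N else true.

Definition absorb (x : option nat) (a : nat) : option nat :=
  omap (fun=> a) x.

(* The sinks at the end of the histories in which every erased letter either
   replaces a greater letter or is absorbed; n is a bound on the size of w. *)
Fixpoint outs (n : nat) (w : seq nat) (x : option nat) : seq (option nat) :=
  if n is m.+1 then
    if w is a :: w' then
      flatten [seq outs m v x | v <- repl a w'] ++
      (if absorbs x a then outs m w' (absorb x a) else [::])
    else [:: x]
  else [:: x].

(** It is positions that are distributed, so there are always [2 ^ size w] splittings, and both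
    parts keep the order of the word. *)
Fixpoint splits (w : seq nat) : seq (seq nat * seq nat) :=
  if w is a :: w' then
    [seq (a :: p.1, p.2) | p <- splits w'] ++
    [seq (p.1, a :: p.2) | p <- splits w']
  else [:: ([::], [::])].

Lemma repl_rcons a w c :
  repl a (rcons w c) =
    [seq rcons v c | v <- repl a w] ++ (if (a < c)%N then [:: rcons w a] else [::]).
Proof.
elim: w => [|y w IHw] /=; first by rewrite cats0.
rewrite IHw !map_cat -!map_comp catA; congr (_ ++ _); last by case: ifP.
by congr (_ ++ _); case: ifP.
Qed.

Lemma size_repl a w v : v \in repl a w -> size v = size w.
Proof.
elim: w v => //= y w IHw v; rewrite mem_cat => /orP[].
  by case: ifP => // _; rewrite inE => /eqP->.
by case/mapP=> u /IHw <- ->.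
Qed.

Lemma sub_repl a w v : v \in repl a w -> {subset v <= a :: w}.
Proof.
elim: w v => //= y w IHw v; rewrite mem_cat => /orP[].
  case: ifP => // _; rewrite inE => /eqP-> z; rewrite !inE => /orP[->//|->].
  by rewrite !orbT.
case/mapP=> u /IHw sub -> z; rewrite !inE => /orP[->|/sub]; rewrite ?orbT //.
by rewrite inE => /orP[->//|->]; rewrite !orbT.
Qed.

Lemma outs_nil n x : outs n [::] x = [:: x].
Proof. by case: n. Qed.

Section Sums.

Variable V : nmodType.

Lemma big_outs_cons w a x (f : option nat -> V) :
  \sum_(o <- outs (size w).+1 (a :: w) x) f o =
    \sum_(v <- repl a w) \sum_(o <- outs (size v) v x) f o +
    (if absorbs x a then \sum_(o <- outs (size w) w (absorb x a)) f o else 0).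
Proof.
rewrite /= big_cat big_flatten big_map /=; congr (_ + _).
  by apply: eq_big_seq => v /size_repl->.
by case: ifP => _; rewrite ?big_nil.
Qed.

Lemma big_splits_cons a w (f : seq nat -> seq nat -> V) :
  \sum_(p <- splits (a :: w)) f p.1 p.2 =
    \sum_(p <- splits w) (f (a :: p.1) p.2 + f p.1 (a :: p.2)).
Proof. by rewrite /= big_cat !big_map big_split. Qed.

Lemma big_splits_sym w (f : seq nat -> seq nat -> V) :
  \sum_(p <- splits w) f p.1 p.2 = \sum_(p <- splits w) f p.2 p.1.
Proof.
elim: w f => [|a w IHw] f; first by rewrite !big_seq1.
rewrite (big_splits_cons _ _ f) (big_splits_cons _ _ (fun u v => f v u)).
rewrite (IHw (fun u v => f (a :: u) v + f u (a :: v))).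
by apply: eq_bigr => p _; rewrite addrC.
Qed.

(** Lowering a letter moves no position, so it commutes with splitting; the lowered letter lies in
    exactly one part. *)
Lemma big_splits_repl a w (f : seq nat -> seq nat -> V) :
  \sum_(v <- repl a w) \sum_(p <- splits v) f p.1 p.2 =
    \sum_(p <- splits w) (\sum_(u <- repl a p.1) f u p.2 +
                          \sum_(v <- repl a p.2) f p.1 v).
Proof.
elim: w f => [|y w IHw] f; first by rewrite big_seq1 /= !big_nil addr0.
rewrite (big_splits_cons _ _ (fun q r => \sum_(u <- repl a q) f u r +
                          \sum_(v <- repl a r) f q v)).
rewrite /= big_cat big_map /=.
under [X in _ + X = _]eq_bigr do rewrite (big_splits_cons _ _ f).
rewrite (IHw (fun u v => f (y :: u) v + f u (y :: v))).
have -> : \sum_(v <- (if (a < y)%N then [:: a :: w] else [::]))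
              \sum_(p <- splits v) f p.1 p.2
    = \sum_(p <- splits w) if (a < y)%N then f (a :: p.1) p.2 + f p.1 (a :: p.2)
                           else 0.
  case: ifP => _; last by rewrite big_nil big1.
  by rewrite big_seq1 (big_splits_cons _ _ f).
rewrite -big_split; apply: eq_bigr => -[u v] _ /=.
rewrite !big_cat !big_map /= !big_split /=.
case: ifP => _; rewrite ?big_seq1 ?big_nil ?add0r.
  by rewrite (AC (2*(2*2)) ((1*3*5)*(4*(2*6)))).
by rewrite addrACA.
Qed.

(* The letters erased before c are divided into those merged into c, which form
   p.1, and those absorbed by x, which form p.2; then c itself is absorbed. *)
Lemma big_outs_rcons w c x (f : option nat -> V) :
  \sum_(o <- outs (size w).+1 (rcons w c) x) f o =
    \sum_(p <- splits w) \sum_(c' <- outs (size p.1) p.1 (Some c))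
      \sum_(x' <- outs (size p.2) p.2 x)
        if c' is Some a then if absorbs x' a then f (absorb x' a) else 0 else 0.
Proof.
have [m] := ubnP (size w); elim: m w c x f => // m IHm [|a w] c x f lt_m.
  by rewrite /= !big_seq1 /=; case: ifP; rewrite ?big_seq1 ?big_nil.
rewrite /= ltnS in lt_m.
set g := fun c' x' => if c' is Some a then if absorbs x' a
                      then f (absorb x' a) else 0 else 0.
pose h c x u v := \sum_(c' <- outs (size u) u (Some c))
                    \sum_(x' <- outs (size v) v x) g c' x'.
have IH v e y : size v = size w ->
    \sum_(o <- outs (size w).+1 (rcons v e) y) f o = \sum_(p <- splits v) h e y p.1 p.2.
  by move=> sz; rewrite -sz IHm ?sz.
have := big_outs_cons (rcons w c) a x f; rewrite size_rcons repl_rcons /= => ->.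
(* The letter [a] joins [p.1] when it lowers a letter of that part or [c] itself; it joins [p.2]
   when it lowers a letter there or is absorbed by [x]. *)
rewrite [RHS](big_splits_cons _ _ (h c x)) big_cat big_map /=.
rewrite (eq_big_seq (fun v => \sum_(p <- splits v) h c x p.1 p.2)); last first.
  by move=> v /size_repl sz; rewrite size_rcons sz IH.
rewrite big_splits_repl (IH w) //.
have -> : \sum_(v <- (if (a < c)%N then [:: rcons w a] else [::]))
              \sum_(o <- outs (size v) v x) f o
    = \sum_(p <- splits w) if (a < c)%N then h a x p.1 p.2 else 0.
  case: ifP => _; last by rewrite big_nil big1.
  by rewrite big_seq1 size_rcons IH.
have -> : (if absorbs x a then \sum_(p <- splits w) h c (absorb x a) p.1 p.2 else 0)
    = \sum_(p <- splits w) if absorbs x a then h c (absorb x a) p.1 p.2 else 0.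
  by case: ifP => // _; rewrite big1.
rewrite -!big_split; apply: eq_bigr => -[u v] _ /=.
have -> : h c x (a :: u) v = \sum_(u' <- repl a u) h c x u' v +
                            if (a < c)%N then h a x u v else 0.
  by rewrite /h /= -/(outs (size u).+1 (a :: u) (Some c)) big_outs_cons.
have -> : h c x u (a :: v) = \sum_(v' <- repl a v) h c x u v' +
                            if absorbs x a then h c (absorb x a) u v else 0.
  rewrite /h exchange_big /= -/(outs (size v).+1 (a :: v) x) big_outs_cons.
  rewrite [X in X + _ = _](eq_bigr (fun v' => \sum_(c' <- outs (size u) u (Some c))
     \sum_(x' <- outs (size v') v' x) g c' x')); last by move=> v' _; exact: exchange_big.
  by congr (_ + _); case: ifP => // _; exact: exchange_big.
by rewrite (AC (2*1*1) ((1*3)*(2*4))).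
Qed.

End Sums.

Lemma perm_splits w p : p \in splits w -> perm_eq (p.1 ++ p.2) w.
Proof.
elim: w p => [|a w IHw] p; first by rewrite inE => /eqP->.
rewrite mem_cat => /orP[] /mapP[q /IHw pq ->] /=; first by rewrite perm_cons.
by rewrite -cat1s perm_catCA /= perm_cons.
Qed.

Lemma subseq_splits w p : p \in splits w -> subseq p.1 w && subseq p.2 w.
Proof.
elim: w p => [|a w IHw] p; first by rewrite inE => /eqP->.
rewrite mem_cat => /orP[] /mapP[q /IHw /andP[s1 s2] ->]; rewrite [_.1]/= [_.2]/=.
  by rewrite (subseq_trans s2 (subseq_cons w a)) /= eqxx s1.
by rewrite (subseq_trans s1 (subseq_cons w a)) /= eqxx s2.
Qed.

(** The first letter goes to either part, which is Pascal's rule. Sums over splittings thus become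
    binomial convolutions. *)
Lemma big_splits_size (V : nmodType) w (f : nat -> nat -> V) :
  \sum_(p <- splits w) f (size p.1) (size p.2) =
    \sum_(k < (size w).+1) f k (size w - k)%N *+ 'C(size w, k).
Proof.
elim: w f => [|a w IHw] f; first by rewrite big_seq1 big_ord1.
rewrite (big_splits_cons _ _ _ (fun u v => f (size u) (size v))) big_split /=.
rewrite (IHw (fun i j => f i.+1 j)) (IHw (fun i j => f i j.+1)).
rewrite [RHS]big_ord_recl bin0 subn0 /=.
under [in RHS]eq_bigr => i _ do rewrite /bump /= add1n subSS binS mulrnDr.
rewrite big_split /= addrA [RHS]addrC; congr (_ + _).
rewrite [in RHS]big_ord_recr /= bin_small // mulr0n addr0.
rewrite big_ord_recl /= bin0 subn0; congr (_ + _).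
by apply: eq_bigr => i _; rewrite /bump /= add1n subnSK.
Qed.

(** The first absorption overwrites the sink, and one must occur because the last letter has nothing
    to its right to lower. Until then all letters stay below both sinks. *)
Lemma outs_top n w b c : w != [::] -> (size w <= n)%N ->
  all (fun a => a < b)%N w -> all (fun a => a < c)%N w ->
  outs n w (Some b) = outs n w (Some c).
Proof.
elim: n w => [|n IHn] [|a w] //= _; rewrite ltnS => le_wn.
move=> /andP[ab wb] /andP[ac wc]; rewrite ab ac; congr (flatten _ ++ _).
apply/eq_in_map => v vw; have sub := sub_repl _ _ _ vw.
case: w le_wn wb wc vw sub => // y w le_wn wb wc /size_repl sz sub.
apply: IHn; rewrite ?sz //; first by case: v sz {sub}.
  by apply/allP=> z /sub; rewrite inE => /predU1P[->//|]; exact: (allP wb).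
by apply/allP=> z /sub; rewrite inE => /predU1P[->//|]; exact: (allP wc).
Qed.

Lemma outs_in n w c o : o \in outs n w (Some c) -> w != [::] ->
  (size w <= n)%N -> exists2 a, a \in w & o = Some a.
Proof.
elim: n w c => [|n IHn] [|a w] c //= ow _; rewrite ltnS => le_wn; move: ow.
rewrite mem_cat => /orP[/flatten_mapP[v vw ov]|].
  have sz := size_repl _ _ _ vw.
  have v0 : v != [::] by case: (v) (w) vw sz => [|? ?] [|? ?].
  have [|d dv ->] := IHn v c ov v0; first by rewrite sz.
  by exists d; rewrite ?(sub_repl _ _ _ vw).
case: ifP => // _ ow; case: (altP (w =P [::])) ow => [->|w0 ow].
  by rewrite outs_nil inE => /eqP->; exists a; rewrite ?inE.
have [d dw ->] := IHn w a ow w0 le_wn.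
by exists d; rewrite // inE dw orbT.
Qed.

(** On increasing words of size [m], the sink [None] gives the number [F m] and a sink above all
    letters gives [E m]. *)
Definition weight (w : seq nat) (x : option nat) : rat :=
  \sum_(o <- outs (size w) w x) 1.

Lemma weight_nil x : weight [::] x = 1.
Proof. exact: big_seq1. Qed.

(** The sink [None] absorbs every letter, so [big_outs_rcons] puts no condition on pairs of
    histories and each summand factors. *)
Lemma weight_rcons_None w c :
  weight (rcons w c) None =
    \sum_(p <- splits w) weight p.1 (Some c) * weight p.2 None.
Proof.
have outs_None n z o : o \in outs n z None -> o = None.
  elim: n z => [|n IHn] [|a z] /=; rewrite ?inE; try by move/eqP.
  by rewrite mem_cat => /orP[/flatten_mapP[v _]|]; exact: IHn.
rewrite /weight size_rcons big_outs_rcons; apply: eq_big_seq => -[u v] puv /=.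
rewrite big_distrl /=; apply: eq_big_seq => o ou.
have [a ->] : exists a, o = Some a.
  case: (altP (u =P [::])) ou => [->|u0]; first by rewrite inE => /eqP->; exists c.
  by case/outs_in=> // a _ ->; exists a.
by rewrite mul1r; apply: eq_big_seq => _ /outs_None ->.
Qed.

(* Exchanging the two parts of a splitting reverses the comparison of their
   final labels, so exactly half of the pairs of histories are admissible. *)
Lemma weight_rcons w c b : all (ltn^~ c) w -> uniq w -> (c < b)%N ->
  weight (rcons w c) (Some b) *+ 2 =
    \sum_(p <- splits w) weight p.1 (Some b) * weight p.2 (Some b) + (w == [::])%:R.
Proof.
move=> wc uw cb; rewrite /weight size_rcons big_outs_rcons.
case: (altP (w =P [::])) => [->|w0]; first by rewrite /= !big_seq1 /= cb mulr1.
pose lt o o' := if o is Some a then (absorbs o' a)%:R else 0 : rat.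
pose U u v := \sum_(o <- outs (size u) u (Some c))
                \sum_(o' <- outs (size v) v (Some b)) lt o o'.
transitivity ((\sum_(p <- splits w) U p.1 p.2) *+ 2).
  congr (_ *+ 2); rewrite /U /lt; apply: eq_bigr => p _; apply: eq_bigr => -[a|] _ //.
  by apply: eq_bigr => o _ /=; case: absorbs.
rewrite mulr2n {1}big_splits_sym -[LHS]big_split addr0 /weight.
apply: eq_big_seq => -[u v] /[dup] /perm_splits /= puv.
case/subseq_splits/andP=> /= su sv.
have wb : all (ltn^~ b) w by apply: sub_all wc => z /ltn_trans; apply.
have lt_cb z : subseq z w -> all (ltn^~ c) z && all (ltn^~ b) z.
  move=> /mem_subseq sz; apply/andP; split; apply/allP=> a /sz.
    exact: (allP wc).
  exact: (allP wb).
(* With one part empty, the sinks decide: all letters of [w] are below [c < b], so an empty second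
   part is always admissible and an empty first part never. *)
have Unil z : z != [::] -> subseq z w ->
    U z [::] + U [::] z = weight z (Some b).
  move=> z0 /lt_cb/andP[zc zb].
  rewrite /U /= big_seq1 [X in _ + X]big1_seq ?addr0; last first.
    move=> o /andP[_ /outs_in []] // a /(allP zc) ac -> /=.
    by rewrite ltnNge (ltnW ac).
  rewrite /weight (outs_top _ _ b c) // ; apply: eq_big_seq => o /outs_in [] // a.
  by move=> /(allP zb) /= ab ->; rewrite big_seq1 /= ab.
case: (altP (u =P [::])) su puv => [->|u0] su puv.
  have v0 : v != [::].
    apply: contra w0 => /eqP v0; rewrite v0 in puv.
    by rewrite -size_eq0 -(perm_size puv).
  by rewrite Unil // big_seq1 mul1r.
case: (altP (v =P [::])) sv puv => [->|v0] sv puv.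
  by rewrite addrC Unil // big_seq1 mulr1.
have /andP[uc ub] := lt_cb u su; have /andP[vc vb] := lt_cb v sv.
(* Both sinks exceed all letters, so [c] may be replaced by [b], and the two sums run over the same
   pairs of histories. *)
rewrite /U -(outs_top _ _ b c) // -(outs_top _ _ b c) // exchange_big -big_split /=.
rewrite  big_distrl /=; apply: eq_big_seq => o /outs_in [] // x xu ->.
rewrite -big_split mul1r /=.
apply: eq_big_seq => o' /outs_in [] // y yv -> /=.
have: x != y.
  apply: contraTneq uw => xy; rewrite -(perm_uniq puv) cat_uniq negb_and.
  apply/orP; right; rewrite negb_and negbK; apply/orP; left.
  by apply/hasP; exists y; rewrite // -xy.
by case: ltngtP.
Qed.

(** * The differential equation of sec + tan *)

(** Congruence to 0 modulo [z ^ N]: power series are handled through truncations, to which [ring]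
    and formal derivatives apply. *)
Definition vanish (N : nat) (p : {poly rat}) : Prop :=
  forall i, (i < N)%N -> p`_i = 0.

Lemma vanishD N p q : vanish N p -> vanish N q -> vanish N (p + q).
Proof. by move=> p0 q0 i iN; rewrite coefD p0 // q0 // addr0. Qed.

Lemma vanishM N p q : vanish N p -> vanish N (q * p).
Proof.
move=> p0 i iN; rewrite coefM big1 // => j _; rewrite p0 ?mulr0 //.
by apply: leq_ltn_trans iN; exact: leq_subr.
Qed.

Lemma vanish_deriv N p : vanish N.+1 p -> vanish N p^`().
Proof. by move=> p0 i iN; rewrite coef_deriv p0 ?mul0rn. Qed.

Lemma vanish_primitive N (p : {poly rat}) : vanish N p^`() -> p`_0 = 0 -> vanish N.+1 p.
Proof.
move=> dp0 p0 [|i] //; rewrite ltnS => /dp0 /eqP; rewrite coef_deriv.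
by rewrite -mulr_natr mulf_eq0 Num.Theory.pnatr_eq0 orbF => /eqP.
Qed.

(** A nonzero constant coefficient makes [q] a unit modulo [z ^ N]. *)
Lemma vanish_cancel N (p q : {poly rat}) : q`_0 != 0 -> vanish N (q * p) -> vanish N p.
Proof.
move=> q0 qp0 i; have [m] := ubnP i; elim: m i => // m IHm i; rewrite ltnS => im iN.
have /eqP := qp0 i iN; rewrite coefM big_ord_recl subn0 big1 => [|j _].
  by rewrite addr0 mulf_eq0 (negPf q0) => /eqP.
have ij : (i - lift ord0 j < i)%N.
  by rewrite lift0 ltn_subrL /= (leq_ltn_trans _ (ltn_ord j)).
by rewrite IHm ?mulr0 //; [exact: leq_trans im | exact: ltn_trans iN].
Qed.

Lemma fps_sin_deriv n : fps_sin n.+1 *+ n.+1 = fps_cos n.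
Proof.
rewrite /fps_sin /fps_cos /= uphalf_half; case: odd => //=; first by rewrite mul0rn.
rewrite -[_ *+ n.+1]mulr_natr -mulrA factS natrM; congr (_ * _).
by rewrite invfM mulrC mulrA mulfV ?mul1r // Num.Theory.pnatr_eq0.
Qed.

Lemma fps_cos_deriv n : fps_cos n.+1 *+ n.+1 = - fps_sin n.
Proof.
rewrite /fps_sin /fps_cos /= uphalf_half; case: odd => /=; last by rewrite mul0rn oppr0.
rewrite -[_ *+ n.+1]mulr_natr -mulrA factS natrM exprS mulN1r mulNr; congr (- (_ * _)).
by rewrite invfM mulrC mulrA mulfV ?mul1r // Num.Theory.pnatr_eq0.
Qed.

Lemma fps_cos0 : fps_cos 0 = 1.
Proof. by rewrite /fps_cos /= fact0 expr0 divr1. Qed.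

Lemma fps_sec0 : fps_sec 0 = 1.
Proof. by rewrite /fps_sec /fps_inv /= fps_cos0 invr1. Qed.

Lemma coef_poly_mul N (f g : nat -> rat) n : (n < N)%N ->
  ((\poly_(i < N) f i) * (\poly_(i < N) g i))`_n = fps_mul f g n.
Proof.
move=> nN; rewrite coefM; apply: eq_bigr => i _; rewrite !coef_poly.
by rewrite (leq_ltn_trans _ nN) ?(leq_ltn_trans _ nN) ?leq_subr // -ltnS.
Qed.

Lemma fps_sec_tan_mul_cos N n : (n < N)%N ->
  ((\poly_(i < N) fps_add fps_sec fps_tan i) * (\poly_(i < N) fps_cos i))`_n
    = fps_one n + fps_sin n.
Proof.
move=> nN.
pose P (f : nat -> rat) := \poly_(i < N) f i.
have secM : vanish N (P fps_sec * P fps_cos - 1).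
  move=> i iN; rewrite coefB coef_poly_mul // fps_mulV; last by rewrite fps_cos0 oner_eq0.
  by rewrite coef1 /fps_one subrr.
have tanE : vanish N (P fps_tan - P fps_sin * P fps_sec).
  by move=> i iN; rewrite coefB coef_poly_mul // coef_poly iN subrr.
have HE : P (fps_add fps_sec fps_tan) = P fps_sec + P fps_tan.
  by apply/polyP=> i; rewrite coefD !coef_poly; case: ifP; rewrite ?addr0.
have : vanish N (P (fps_add fps_sec fps_tan) * P fps_cos - (1 + P fps_sin)).
  have -> : P (fps_add fps_sec fps_tan) * P fps_cos - (1 + P fps_sin) =
     (1 + P fps_sin) * (P fps_sec * P fps_cos - 1) +
     P fps_cos * (P fps_tan - P fps_sin * P fps_sec) by rewrite HE; ring.
  by apply: vanishD; apply: vanishM.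
move=> /(_ n nN) /eqP; rewrite coefB subr_eq0 => /eqP ->.
by rewrite coefD coef1 coef_poly nN.
Qed.

(* From h cos = 1 + sin one gets 2 h' cos^2 = (h^2 + 1) cos^2; cancel cos^2. *)
Lemma sec_tan_ode n :
  fps_add fps_sec fps_tan n.+1 *+ n.+1 *+ 2 =
    fps_mul (fps_add fps_sec fps_tan) (fps_add fps_sec fps_tan) n + fps_one n.
Proof.
set h := fps_add _ _; pose N := n.+1.
(* The truncation keeps one order more than [N], since differentiation loses one. *)
pose P (f : nat -> rat) := \poly_(i < N.+1) f i.
pose S := P fps_sin; pose C := P fps_cos; pose H := P h.
have dS : vanish N (S^`() - C).
  move=> i iN; rewrite coefB coef_deriv !coef_poly ltnS iN ltnS ltnW //.
  by rewrite fps_sin_deriv subrr.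
have dC : vanish N (C^`() + S).
  move=> i iN; rewrite coefD coef_deriv !coef_poly ltnS iN ltnS ltnW //.
  by rewrite fps_cos_deriv addNr.
have HC : vanish N.+1 (H * C - 1 - S).
  move=> i iN; rewrite !coefB fps_sec_tan_mul_cos // coef1 coef_poly iN.
  by rewrite -addrA -opprD subrr.
have C0 : C`_0 = 1 by rewrite coef_poly fps_cos0.
have pythagoras : vanish N.+1 (S * S + C * C - 1).
  apply: vanish_primitive.
    rewrite !derivE.
    have -> : S^`() * S + S * S^`() + (C^`() * C + C * C^`()) - 0 =
      (2 * S) * (S^`() - C) + (2 * C) * (C^`() + S) by ring.
    by apply: vanishD; apply: vanishM.
  by rewrite coefB coefD !coef0M C0 coef1 coef_poly /fps_sin /= mulr0 mulr1 add0r subrr.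
have dHC : vanish N (H^`() * C + H * C^`() - S^`()).
  by have := vanish_deriv _ _ HC; rewrite !derivE subr0.
have weak p : vanish N.+1 p -> vanish N p by move=> p0 i iN; apply: p0; exact: ltnW.
have : vanish N (2 * H^`() - H * H - 1).
  apply: (@vanish_cancel _ _ (C * C)); first by rewrite coef0M C0 mulr1 oner_eq0.
  (* Substituting [H' C = S' - H C'], [S' = C], [C' = - S] and [H C = 1 + S] leaves [S^2 + C^2 - 1];
     the cofactors record these substitutions. *)
  have -> : C * C * (2 * H^`() - H * H - 1) =
     (2 * C) * (H^`() * C + H * C^`() - S^`()) + (- 2 * H * C) * (C^`() + S) +
     (2 * C) * (S^`() - C) + (2 * S - (H * C - 1 - S + 2 + 2 * S)) * (H * C - 1 - S) +
     1 * (S * S + C * C - 1) by ring.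
  do ![apply: vanishD]; apply: vanishM => //; exact: weak.
move=> /(_ n (ltnSn n)) /eqP; rewrite !coefB !subr_eq add0r => /eqP.
rewrite coef_poly_mul ?ltnS // coef1 addrC mulr_natl coefMn coef_deriv.
by rewrite coef_poly /N !ltnS leqnn.
Qed.

(** * Recurrences for the Euler numbers *)

Lemma euler0 : euler 0 = 1.
Proof.
rewrite /euler /fps_add /fps_tan /fps_mul big_ord1 /fps_sin /=.
by rewrite mul0r addr0 mul1r fps_sec0.
Qed.

Lemma euler_rec n :
  euler n.+1 *+ 2 =
    \sum_(k < n.+1) (euler k * euler (n - k)) *+ 'C(n, k) + (n == 0)%:R.
Proof.
rewrite /euler factS natrM; set h := fps_add _ _.
transitivity (n`!%:R * (h n.+1 *+ n.+1 *+ 2)).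
  by rewrite [RHS]mulrnAr -[h _ *+ n.+1]mulr_natl mulrCA mulrA.
rewrite sec_tan_ode -/h mulrDr mulr_sumr; congr (_ + _); last first.
  by rewrite /fps_one; case: n => [|n]; rewrite ?mulr0 ?mulr1.
apply: eq_bigr => k _; have kn : (k <= n)%N by rewrite -ltnS.
rewrite -(bin_fact kn) !natrM -[_ *+ 'C(n, k)]mulr_natr; ring.
Qed.

Lemma rat_double_inj (x y : rat) : x *+ 2 = y *+ 2 -> x = y.
Proof. by rewrite -[x *+ 2]mulr_natr -[y *+ 2]mulr_natr => /mulIf->. Qed.

Lemma euler1 : euler 1 = 1.
Proof.
apply: rat_double_inj; rewrite euler_rec big_ord1 euler0 mulr1 bin0 [RHS]mulr2n.
reflexivity.
Qed.

(** * Weights of increasing words *)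

(** This is [y'' = y y'], the derivative of [2 y' = y^2 + 1]. Adding a letter to a split word acts
    as the Leibniz rule, whose two terms agree by symmetry. *)
Lemma euler_derivative_rec n :
  euler n.+2 = \sum_(k < n.+1) (euler k * euler (n - k).+1) *+ 'C(n, k).
Proof.
(* Any word of size [n] can index the binomial sum. *)
rewrite -(size_nseq n 0%N); move: (nseq n 0%N) => w; apply: rat_double_inj.
rewrite euler_rec addr0 -[(size w).+1]/(size (0%N :: w)).
rewrite -(big_splits_size _ (_ :: w) (fun i j => euler i * euler j)).
rewrite (big_splits_cons _ _ _ (fun u v => euler (size u) * euler (size v))) big_split /=.
rewrite [X in X + _](big_splits_sym _ _ (fun u v => euler (size u).+1 * euler (size v))).
rewrite -(big_splits_size _ _ (fun i j => euler i * euler j.+1)) mulr2n.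
by congr (_ + _); apply: eq_bigr => p _; rewrite mulrC.
Qed.

(** Removing the last letter, which is the largest, turns [weight_rcons] into [euler_rec]. *)
Lemma weight_increasing w b : sorted ltn w -> all (ltn^~ b) w ->
  weight w (Some b) = euler (size w).
Proof.
have [m] := ubnP (size w); elim: m w => // m IHm w.
case/lastP: w => [|w c]; first by rewrite weight_nil euler0.
rewrite size_rcons ltnS => le_wm w_sorted; rewrite all_rcons => /andP[cb wb].
have [ws wc] : sorted ltn w /\ all (ltn^~ c) w.
  move: w_sorted; rewrite !(sorted_pairwise ltn_trans) pairwise_rcons.
  by case/andP.
apply: rat_double_inj; rewrite weight_rcons //; last first.
  exact: sorted_uniq ltn_trans ltnn _ ws.
rewrite euler_rec size_eq0 -(big_splits_size _ _ (fun i j => euler i * euler j)).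
congr (_ + _); apply: eq_big_seq => p pw; have /andP[s1 s2] := subseq_splits _ _ pw.
rewrite !IHm //; first [exact: (subseq_sorted ltn_trans _ ws) |
  exact: leq_ltn_trans (size_subseq _) le_wm | idtac].
all: try exact: leq_ltn_trans (size_subseq _) le_wm.
all: by apply/allP=> z /(mem_subseq _) zw; apply: (allP wb); apply: zw.
Qed.

(** The removed last letter is a sink above the first part, so [weight_rcons_None] becomes the
    recurrence of [y'' = y y']. *)
Lemma weight_increasing_None w : sorted ltn w -> weight w None = euler (size w).+1.
Proof.
have [m] := ubnP (size w); elim: m w => // m IHm w.
case/lastP: w => [|w c]; first by rewrite weight_nil euler1.
rewrite size_rcons ltnS => le_wm w_sorted.
have [ws wc] : sorted ltn w /\ all (ltn^~ c) w.
  move: w_sorted; rewrite !(sorted_pairwise ltn_trans) pairwise_rcons.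
  by case/andP.
rewrite weight_rcons_None euler_derivative_rec.
rewrite -(big_splits_size _ _ (fun i j => euler i * euler j.+1)).
apply: eq_big_seq => p pw; have /andP[s1 s2] := subseq_splits _ _ pw.
rewrite IHm; first last.
- exact: (subseq_sorted ltn_trans s2 ws).
- exact: leq_ltn_trans (size_subseq s2) le_wm.
rewrite weight_increasing //; first exact: (subseq_sorted ltn_trans s1 ws).
by apply/allP=> z /(mem_subseq s1); exact: (allP wc).
Qed.

(** * Confluence of the resolutions *)

Lemma cell_ge_trans n (a b c : cell n) : cell_ge a b -> cell_ge b c -> cell_ge a c.
Proof.
by move=> /andP[a1 a2] /andP[b1 b2]; rewrite /cell_ge (leq_trans a1) // (leq_trans b2).
Qed.

Lemma maximal_incomparable n (g : config n) c d :
  maximal_remaining g c -> maximal_remaining g d -> c != d -> ~~ cell_ge c d.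
Proof.
case/andP=> cr _ /andP[_ /forall_inP/(_ c cr)/implyP dmax].
by apply: contra => /dmax.
Qed.

Lemma maximal_smoothing n (g : config n) c d :
  maximal_remaining g c -> c != d -> maximal_remaining (smoothing g d) c.
Proof.
case/andP=> cr /forall_inP cmax cd; apply/andP; split.
  by move: cr; rewrite /remaining !in_setD in_setU1 (negPf cd).
apply/forall_inP=> e; rewrite /remaining in_setD in_setU1 negb_or -andbA.
by case/and3P=> _ eE eCr; apply: cmax; rewrite in_setD eE.
Qed.

(** The switch at [d] affects only crossings below [d]; a cell above [c] is not below [d], as [c]
    and [d] are incomparable. *)
Lemma maximal_switching n (g : config n) c d :
  maximal_remaining g c -> maximal_remaining g d -> c != d ->
  maximal_remaining (switching g d) c.
Proof.
move=> mc md cd; have dc := maximal_incomparable _ _ _ _ md mc.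
rewrite eq_sym in dc; move/(_ cd) in dc.
have /andP[dr _] := md; have /andP[cr /forall_inP cmax] := mc.
have dCr : d \in crossings g.1 by move: dr; rewrite in_setD => /andP[].
apply/andP; split.
  by move: cr; rewrite /remaining !in_setD switch_crossingE.
apply/forall_inP=> e; rewrite /remaining in_setD => /andP[eE eCr].
apply/implyP=> ec; apply: (implyP (cmax e _)) => //.
rewrite in_setD eE -(switch_crossingE dCr) //.
by apply: contra dc => /cell_ge_trans; apply.
Qed.

Lemma switch_permC n (s : 'S_n) c d :
  c \in crossings s -> d \in crossings s -> c != d ->
  ~~ cell_ge c d -> ~~ cell_ge d c ->
  switch_perm (switch_perm s c) d = switch_perm (switch_perm s d) c.
Proof.
wlog lt_cd : c d / (c.1 < d.1)%N => [hwlog cCr dCr cd ncd ndc|].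
  case: (ltngtP c.1 d.1) => [lt_cd|lt_dc|eq1]; first exact: hwlog.
    by rewrite [RHS]hwlog // eq_sym.
  move: ncd ndc; rewrite /cell_ge eq1 leqnn /= -!ltnNge.
  by move=> /ltn_trans lt_trans /lt_trans; rewrite ltnn.
case: c d lt_cd => [i j] [x y] /= ix; rewrite !inE /= => /andP[sij ij] /andP[sxy xy] _.
rewrite /cell_ge /= (ltnW ix) /= -ltnNge => jy _.
rewrite /switch_perm /= !invMg !tpermV !permM.
set k := (s^-1)%g j in ij *; set l := (s^-1)%g y in xy *.
have ik : i != k by rewrite -val_eqE /= ltn_eqF.
have i_x : i != x by rewrite -val_eqE /= ltn_eqF.
have i_l : i != l by rewrite -val_eqE /= ltn_eqF // (ltn_trans ix).
have k_l : k != l by rewrite (inj_eq perm_inj) -val_eqE /= ltn_eqF.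
rewrite [tperm i k l]tpermD // !mulgA; congr (_ * s)%g.
by rewrite [RHS]conjgC tpermJ tpermK tpermD // eq_sym.
Qed.

Lemma resolve_smoothing n (g : config n) c :
  maximal_remaining g c -> resolve g (smoothing g c).
Proof. by move=> mc; apply/existsP; exists c; rewrite mc eqxx. Qed.

Lemma resolve_switching n (g : config n) c :
  maximal_remaining g c -> resolve g (switching g c).
Proof. by move=> mc; apply/existsP; exists c; rewrite mc eqxx orbT. Qed.

(** If a run first resolves some [d != c], then [c] stays maximal and the two resolutions commute,
    so by induction on the run [c] can be moved to the front. *)
Lemma connect_maximal n (g : config n) c (t : 'S_n) :
  maximal_remaining g c ->
  connect (@resolve n) g (t, crossings t) =
    connect (@resolve n) (smoothing g c) (t, crossings t) ||
    connect (@resolve n) (switching g c) (t, crossings t).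
Proof.
move=> mc; apply/idP/orP=> [|[]]; first last.
- by apply: connect_trans; apply/connect1/resolve_switching.
- by apply: connect_trans; apply/connect1/resolve_smoothing.
case/connectP=> p; elim: p g mc => [|h p IHp] g mc /=.
  by move=> _ def_g; move: mc; rewrite -def_g /maximal_remaining /remaining /= setDv inE.
case/andP=> /existsP[d /andP[md gh]] hp lastp.
have conn : connect (@resolve n) h (t, crossings t) by apply/connectP; exists p.
case: (altP (c =P d)) => [->|cd].
  by case/orP: gh => /eqP<-; [left | right].
have dc : d != c by rewrite eq_sym.
have crossing e : maximal_remaining g e -> e \in crossings g.1.
  by case/andP; rewrite in_setD => /andP[].
have swC := switch_permC _ _ _ _ (crossing _ mc) (crossing _ md) cd
  (maximal_incomparable _ _ _ _ mc md cd) (maximal_incomparable _ _ _ _ md mc dc).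
case/orP: gh => /eqP def_h.
  have mh : maximal_remaining h c by rewrite def_h maximal_smoothing.
  case: (IHp h mh hp lastp) => conn_h; [left | right];
    apply: connect_trans conn_h; apply: connect1; rewrite def_h.
    have -> : smoothing (smoothing g d) c = smoothing (smoothing g c) d.
      by congr (_, _); rewrite setUCA.
    by apply: resolve_smoothing; apply: maximal_smoothing.
  by apply: (resolve_smoothing _ (switching g c) d); apply: maximal_switching.
have mh : maximal_remaining h c by rewrite def_h maximal_switching.
case: (IHp h mh hp lastp) => conn_h; [left | right];
  apply: connect_trans conn_h; apply: connect1; rewrite def_h.
  by apply: (resolve_switching _ (smoothing g c) d); apply: maximal_smoothing.
have -> : switching (switching g d) c = switching (switching g c) d.
  by congr (_, _).
by apply: resolve_switching; apply: maximal_switching.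
Qed.

(** * Resolution column by column *)

(* Columns before k have been resolved completely, column k down to row j. *)
Definition resolved_upto {n} (s : 'S_n) (k j : nat) : {set cell n} :=
  [set c in crossings s | (c.1 < k)%N || (c.1 == k :> nat) && (j <= c.2)%N].

(** Rows end at [n - 1], so the bound [n] leaves column [k] untouched. *)
Definition web_from {n} (s : 'S_n) (k : nat) : {set 'S_n} :=
  [set t | connect (@resolve n) (s, resolved_upto s k n) (t, crossings t)].

Lemma resolved_uptoS n (s : 'S_n) (k j : 'I_n) :
  resolved_upto s k j =
    if (k, j) \in crossings s then (k, j) |: resolved_upto s k j.+1
    else resolved_upto s k j.+1.
Proof.
have -> : resolved_upto s k j = [set c in crossings s | (c == (k, j)) ||
            (c \in resolved_upto s k j.+1)].
  apply/setP=> -[x y]; rewrite !inE xpair_eqE -!val_eqE /= [(j <= y)%N]leq_eqVlt.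
  rewrite [(j == y :> nat)]eq_sym; case: (s x < y)%N => //=; case: (x < _)%N => //=.
  by case: (x < k)%N; rewrite ?orbT //= andb_orr.
case: ifP => kj; apply/setP=> c; rewrite !inE; case: (altP (c =P (k, j))) => [->|_] //=.
- by move: kj; rewrite inE => ->.
- by rewrite andbA andbb.
- by move: kj; rewrite inE => ->.
- by rewrite andbA andbb.
Qed.

Lemma resolved_upto0 n (s : 'S_n) (k : nat) :
  resolved_upto s k 0 = resolved_upto s k.+1 n.
Proof.
apply/setP=> -[x y]; rewrite !inE /= [(n <= y)%N]leqNgt ltn_ord andbF andbT orbF ltnS.
by rewrite [(x <= k)%N]leq_eqVlt orbC.
Qed.

(** After the switch the value at [k] is [j], so column [k] has no crossing in rows up to [j]: one
    switch completes the column. *)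
Lemma resolved_upto_switch n (s : 'S_n) (k j : 'I_n) :
  (k, j) \in crossings s ->
  resolved_upto (switch_perm s (k, j)) k.+1 n = resolved_upto s k j.+1.
Proof.
move=> kj; apply/setP=> -[x y]; rewrite -resolved_upto0 /resolved_upto.
rewrite in_set [RHS]in_set.
case: (boolP (cell_ge (k, j) (x, y))) => [|nge]; last first.
  rewrite switch_crossingE //; congr (_ && _) => /=; case: ltngtP => //= kx.
  by move: nge; rewrite /cell_ge /= kx leqnn /= -ltnNge => ->.
rewrite /cell_ge /= => /andP[kx yj]; rewrite ltnNge kx /= ltnNge yj !andbF /=.
rewrite andbT; apply: contraTF yj => /andP[xy /eqP/val_inj def_x].
move: xy; rewrite def_x inE /= => /andP[].
by case: (switch_permE s k j) => -> _ _ jy _; rewrite -ltnNge.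
Qed.

(** Going down column [k], either all crossings are smoothed or a first switch, in row [i], ends the
    column. *)
Lemma connect_column n (s t : 'S_n) (k : 'I_n) (j : nat) : (j <= n)%N ->
  connect (@resolve n) (s, resolved_upto s k j) (t, crossings t) =
    (t \in web_from s k.+1) || [exists i : 'I_n,
      [&& (i < j)%N, (k, i) \in crossings s
        & t \in web_from (switch_perm s (k, i)) k.+1]].
Proof.
elim: j => [|j IHj] jn.
  by rewrite resolved_upto0 inE; case: existsP => [[]//|]; rewrite orbF.
pose oj := Ordinal jn; have := resolved_uptoS _ s k oj; rewrite /= => stepE.
pose Q m := [exists i : 'I_n, [&& (i < m)%N, (k, i) \in crossings s
                & t \in web_from (switch_perm s (k, i)) k.+1]].
rewrite -/(Q j.+1).
have QS : Q j.+1 =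
    Q j || ((k, oj) \in crossings s) && (t \in web_from (switch_perm s (k, oj)) k.+1).
  apply/existsP/orP=> [[i /and3P[]]|[/existsP[i /and3P[ij ki ti]]|ti]].
  - rewrite ltnS leq_eqVlt => /predU1P[ij|ij] ki ti; [right | left].
      have def_i : i = oj by apply: val_inj.
      by rewrite -def_i ki.
    by apply/existsP; exists i; rewrite ij ki.
  - by exists i; rewrite ltnW // ki.
  - by exists oj; rewrite /= ltnSn.
rewrite QS orbA -IHj; last exact: ltnW.
rewrite stepE; case: ifP => kj; last by rewrite orbF.
have mkj : maximal_remaining (s, resolved_upto s k j.+1) (k, oj).
  apply/andP; split; first by rewrite /remaining in_setD kj in_set /= !ltnn !andbF.
  apply/forall_inP=> -[x y]; rewrite in_setD => /andP[xyE xyCr].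
  apply/implyP=> /andP[/= xk jy]; move: xyE.
  rewrite inE xyCr /= negb_or negb_and -!leqNgt => /andP[kx].
  have -> /= : x == k :> nat by rewrite eqn_leq xk kx.
  move=> yj; rewrite xpair_eqE -!val_eqE /=.
  by rewrite !eqn_leq xk kx yj jy.
rewrite (connect_maximal _ _ _ _ mkj) /=; congr (_ || _).
by rewrite inE resolved_upto_switch.
Qed.

Lemma web_fromE n (s : 'S_n) (k : 'I_n) t :
  (t \in web_from s k) = (t \in web_from s k.+1) ||
    [exists j, ((k, j) \in crossings s) && (t \in web_from (switch_perm s (k, j)) k.+1)].
Proof.
rewrite [in LHS]inE connect_column //; congr (_ || _).
by apply: eq_existsb => i; rewrite ltn_ord.
Qed.

Lemma web_from_end n (s : 'S_n) : web_from s n = [set s].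
Proof.
have -> : web_from s n = [set t | connect (@resolve n) (s, crossings s) (t, crossings t)].
  apply/setP=> t; rewrite !inE; congr (connect _ (_, _) _).
  by apply/setP=> c; rewrite inE ltn_ord andbT.
apply/setP=> t; rewrite !inE; apply/idP/eqP=> [|->]; last exact: connect0.
case/connectP=> -[|h p] /=; first by move=> _ [].
case/andP=> /existsP[c /andP[/andP[]]].
by rewrite /remaining /= setDv inE.
Qed.

(** A switch in a column exchanges its value with one further to the right, so columns already
    passed are frozen. *)
Lemma web_from_prefix n (s t : 'S_n) (k : nat) (i : 'I_n) :
  (k <= n)%N -> t \in web_from s k -> (i < k)%N -> t i = s i.
Proof.
move=> kn; have [m def_m] : exists m, (m + k = n)%N by exists (n - k)%N; rewrite subnK.
elim: m k s kn def_m => [|m IHm] k s kn def_m.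
  by have -> : k = n :> nat by []; rewrite web_from_end inE => /eqP->.
have lt_kn : (k < n)%N by rewrite -def_m addSn ltnS leq_addl.
rewrite (web_fromE _ s (Ordinal lt_kn)) => /orP[|/existsP[j /andP[kj]]] tw ik.
  by rewrite (IHm k.+1 s lt_kn _ tw) ?addnS //; exact: ltnW.
rewrite (IHm k.+1 _ lt_kn _ tw) ?addnS //; last exact: ltnW.
case: (switch_permE s (Ordinal lt_kn) j) => _ _; apply.
  by rewrite -val_eqE /= ltn_eqF.
rewrite -val_eqE /= ltn_eqF // (ltn_trans ik) //.
by move: kj; rewrite inE => /andP[].
Qed.

(** The alternatives of [web_fromE] are disjoint: the final value at [k] is [s k] without a switch
    and [j > s k] after a switch in row [j]. *)
Lemma card_web_from n (s : 'S_n) (k : 'I_n) :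
  #|web_from s k| = (#|web_from s k.+1| +
    \sum_(j | (k, j) \in crossings s) #|web_from (switch_perm s (k, j)) k.+1|)%N.
Proof.
have kn := ltn_ord k.
have prefix (u t : 'S_n) : t \in web_from u k.+1 -> t k = u k.
  by move=> tu; apply: (web_from_prefix _ _ _ _ _ kn tu).
under [X in (_ = _ + X)%N]eq_bigr do rewrite -sum1_card big_mkcond.
rewrite exchange_big /= -!sum1_card !(big_mkcond (fun t => t \in _)) -big_split /=.
apply: eq_bigr => t _; rewrite web_fromE; case: existsP => [[j /andP[kj tj]]|ex].
  have tk : t k = j by rewrite (prefix _ _ tj); case: (switch_permE s k j).
  rewrite (bigD1 j) //= tj big1 ?addn0 ?orbT => [|i /andP[ki ij]].
    case: ifP => // /prefix ts; move: kj; rewrite inE /= -ts tk ltnn //.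
  case: ifP => // /prefix; rewrite tk; case: (switch_permE s k i) => -> _ _ ji.
  by rewrite ji eqxx in ij.
rewrite orbF big1 ?addn0 // => j kj; case: ifP => // tj.
by case: ex; exists j; rewrite kj.
Qed.

(** * Web permutations counted by histories of words *)

Lemma big_repl_map (V : nmodType) (T : eqType) a (g : T -> nat) (l : seq T)
    (f : seq nat -> V) : uniq l ->
  \sum_(v <- repl a (map g l)) f v =
    \sum_(q <- l | (a < g q)%N) f [seq if z == q then a else g z | z <- l].
Proof.
elim: l f => [|y l IHl] f /=; first by rewrite !big_nil.
case/andP=> yl ul; rewrite big_cat /= big_map IHl // big_cons eqxx.
have tailE : [seq if z == y then a else g z | z <- l] = map g l.
  by apply/eq_in_map => z zl; case: eqP => // zy; rewrite -zy zl in yl.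
have sumE : \sum_(q <- l | (a < g q)%N) 
      f (g y :: [seq if z == q then a else g z | z <- l])
    = \sum_(q <- l | (a < g q)%N) f [seq if z == q then a else g z | z <- y :: l].
  rewrite big_seq_cond [RHS]big_seq_cond; apply: eq_bigr => q /andP[ql _] /=.
  by case: eqP => // yq; rewrite yq ql in yl.
by rewrite tailE sumE; case: ifP => _; rewrite ?big_seq1 ?big_nil ?add0r.
Qed.

Lemma mem_drop_enum n k (q : 'I_n) : (q \in drop k (enum 'I_n)) = (k <= q)%N.
Proof.
rewrite -(mem_map val_inj) map_drop val_enum_ord drop_iota add0n mem_iota.
apply: andb_idr => kq; rewrite subnKC ?ltn_ord //.
exact: leq_trans kq (ltnW (ltn_ord q)).
Qed.

(** Smoothing all of column [k] is absorption of [s k] by the sink [None]; a switch puts [s k] in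
    place of a larger letter to its right, which is a move of [repl]. *)
Lemma weight_web_from n (s : 'S_n) k : (k <= n)%N ->
  (#|web_from s k|)%:R = weight [seq s i : nat | i <- drop k (enum 'I_n)] None.
Proof.
move=> kn; have [m def_m] : exists m, (m + k = n)%N by exists (n - k)%N; rewrite subnK.
elim: m k s kn def_m => [|m IHm] k s kn def_m.
  have -> : k = n :> nat by [].
  by rewrite web_from_end cards1 drop_oversize ?size_enum_ord // weight_nil.
have lt_kn : (k < n)%N by rewrite -def_m addSn ltnS leq_addl.
pose ok := Ordinal lt_kn; have := card_web_from _ s ok; rewrite /= => ->.
have IH u : (#|web_from u k.+1|)%:R =
    weight [seq u i : nat | i <- drop k.+1 (enum 'I_n)] None.
  by apply: IHm; rewrite // addnS.
rewrite (drop_nth ok) ?size_enum_ord // -[k]/(ok : nat) nth_ord_enum [map _ _]/=.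
rewrite {1}/weight /= big_outs_cons /=.
have ul : uniq (drop k.+1 (enum 'I_n)) by rewrite drop_uniq ?enum_uniq.
rewrite big_repl_map // natrD natr_sum IH addrC; congr (_ + _).
(* Rows [j] are reindexed by the positions [q] with [s q = j], the indices used by
   [big_repl_map]. *)
rewrite (reindex_inj (@perm_inj _ s)) /= big_mkcond [RHS]big_mkcond [RHS]big_uniq //=.
rewrite [RHS]big_mkcond; apply: eq_bigr => q _; rewrite inE /= permK mem_drop_enum.
rewrite andbC; case: ltnP => //= kq; case: ifP => // _; rewrite IH; congr (weight _ _).
apply/eq_in_map => z; rewrite mem_drop_enum => kz.
have [_ switch_q switch_id] := switch_permE s ok (s q).
rewrite permK in switch_q switch_id.
case: eqP => [->|/eqP zq]; first by rewrite switch_q.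
by rewrite switch_id // -val_eqE /= gtn_eqF.
Qed.

Theorem corollary4p2 (n : nat) (hn : (1 <= n)%N) :
  (#|web_permutations n|)%:R = euler n.+1.
Proof.
have -> : web_permutations n = web_from 1%g 0.
  apply/setP=> t; rewrite !inE; congr (connect _ (_, _) _).
  by apply/setP=> c; rewrite !inE ltn0 /= [(n <= _)%N]leqNgt ltn_ord !andbF.
rewrite weight_web_from // drop0.
have -> : [seq (1%g : 'S_n) i : nat | i <- enum 'I_n] = iota 0 n.
  by rewrite -val_enum_ord; apply: eq_map => i; rewrite perm1.
by rewrite weight_increasing_None ?iota_ltn_sorted // size_iota.
Qed.
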